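(* Let $k$ be a field, let $a\ge 1$, let $R=k[x_1,\dots,x_a]$, and let $p_1,\dots,p_n\in R$ ($n\ge 1$) be monomials. For $1\le r\le n$ and $1\le j_1<j_2<\dots<j_r\le n$ put $d_{j_1j_2\cdots j_r}=\deg\big(\mathrm{lcm}(p_{j_1},p_{j_2},\dots,p_{j_r})\big)$. Then for every integer $b\ge 0$, $$\mathrm{HF}(\langle p_1,\dots,p_n\rangle,b)=\sum_{r=1}^{n}\Big((-1)^{r-1}\sum_{1\le j_1<j_2<\dots<j_r\le n}F(a,b-d_{j_1j_2\cdots j_r})\Big)$$ and $$\mathrm{HF}(R/\langle p_1,\dots,p_n\rangle,b)=F(a,b)-\sum_{r=1}^{n}\Big((-1)^{r-1}\sum_{1\le j_1<j_2<\dots<j_r\le n}F(a,b-d_{j_1j_2\cdots j_r})\Big).$$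
   Context: Polynomial rings over $k$ are graded by total degree; a monomial ideal $I$ (an ideal generated by monomials) and the quotient $R/I$ inherit this grading. For a graded module $M=\bigoplus_b M_b$, the Hilbert function is $\mathrm{HF}(M,b)=\dim_k M_b$. $F(a,b)$ denotes the number of monomials of degree $b$ in $k[x_1,\dots,x_a]$ for $b\ge 0$, and by convention $F(a,b)=0$ for $b<0$. *)

(* Defs.v *)
From HB Require Import structures.
From mathcomp Require Import all_boot all_order all_algebra.
From mathcomp Require Import ring_quotient.
From mathcomp Require Import boolp.
From mathcomp Require Import mpoly.

Set Implicit Arguments.
Unset Strict Implicit.
Unset Printing Implicit Defensive.

Import GRing.Theory.

Local Open Scope ring_scope.
Local Open Scope quotient_scope.

Section Dimension.
Variables (k : fieldType) (V : lmodType k).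
Implicit Type W : V -> Prop.

Definition is_basis W (d : nat) (e : 'I_d -> V) : Prop :=
  (forall c : 'I_d -> k, \sum_i c i *: e i = 0 -> forall i, c i = 0) /\
  (forall v, W v <-> exists c : 'I_d -> k, v = \sum_i c i *: e i).

Definition has_dim W (d : nat) : Prop := exists e : 'I_d -> V, is_basis W e.

(* [V] may be infinite-dimensional, hence no [{vspace V}].  The value is 0    *)
(* when [W] has no finite basis; by [dimensionE] below it is the number of    *)
(* elements of any basis otherwise.                                           *)
Definition dimension W : nat :=
  if pselect (exists d, has_dim W d) is left h then sval (cid h) else 0%N.

Lemma has_dim_leq W d d' : has_dim W d -> has_dim W d' -> (d <= d')%N.
Proof.
move=> [e [fe We]] [e' [_ We']].
have We_i i : W (e i).
  apply/We; exists (fun j => (j == i)%:R).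
  by rewrite (bigD1 i) //= eqxx scale1r big1 ?addr0 // => j /negPf->; rewrite scale0r.
have /choice[A eA] : forall i, exists c : 'I_d' -> k, e i = \sum_j c j *: e' j.
  by move=> i; apply/We'.
pose M := \matrix_(i, j) A i j.
suff : row_free M by move/eqP => <-; exact: rank_leq_col.
rewrite -kermx_eq0; apply/eqP/row_matrixP => i; rewrite row0.
have kM : row i (kermx M) *m M = 0 by apply/sub_kermxP/row_sub.
apply/rowP => j; rewrite [RHS]mxE.
apply: (fe (fun j => row i (kermx M) 0 j)).
under eq_bigr => l _ do rewrite eA scaler_sumr.
rewrite exchange_big big1 //= => l _.
under eq_bigr => m _ do rewrite scalerA.
rewrite -scaler_suml; have /rowP/(_ l) := kM; rewrite !mxE.
under [in X in X = _ -> _]eq_bigr => m _ do rewrite [M _ _]mxE.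
by move=> ->; rewrite scale0r.
Qed.

Lemma dimensionE W d : has_dim W d -> dimension W = d.
Proof.
move=> Wd; rewrite /dimension; case: pselect => [h|[]]; last by exists d.
by case: cid => d' /= Wd'; apply/eqP; rewrite eqn_leq !(@has_dim_leq W).
Qed.

(* [gr b] is the degree [b] component of the graded module [V]. *)
Definition HF (gr : nat -> V -> Prop) (b : nat) : nat := dimension (gr b).

End Dimension.

(* [submodClosed] does not provide closure under opposite, so closure under   *)
(* scaling is taken separately, as an argument of the quotient.               *)
Section QuotientModule.
Variables (k : pzRingType) (V : lmodType k) (S : zmodClosed V).

Definition quotmod (_ : scaler_closed S) : Type := Quotient.quot S.

Variable SZ : scaler_closed S.
Local Notation Q := (quotmod SZ).

HB.instance Definition _ := GRing.Zmodule.on Q.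
HB.instance Definition _ := EqQuotient.on Q.

Definition quotmod_scale (c : k) (u : Q) : Q :=
  \pi_Q (c *: repr u).

Lemma pi_quotmod_scale c v :
  quotmod_scale c (\pi_Q v) = \pi_Q (c *: v).
Proof.
rewrite /quotmod_scale; apply/eqP.
rewrite -[_ == _]/(_ == _ %[mod Quotient.quot S]) -Quotient.idealrBE.
rewrite -scalerBr SZ //.
by rewrite Quotient.idealrBE -[_ == _]/(\pi_Q _ == \pi_Q _) reprK.
Qed.

Lemma pi_quotmodD u v :
  \pi_Q (u + v) = \pi_Q u + \pi_Q v.
Proof. exact: (raddfD (\pi_(Quotient.quot S))). Qed.

Lemma quotmod_scaleA c d u :
  quotmod_scale c (quotmod_scale d u) = quotmod_scale (c * d) u.
Proof. by rewrite -[u]reprK (pi_quotmod_scale d) !pi_quotmod_scale scalerA. Qed.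

Lemma quotmod_scale1 : left_id 1 quotmod_scale.
Proof. by move=> u; rewrite -[u]reprK pi_quotmod_scale scale1r. Qed.

Lemma quotmod_scaleDr : right_distributive quotmod_scale +%R.
Proof.
move=> c u v; rewrite -[u]reprK -[v]reprK.
by rewrite -pi_quotmodD !pi_quotmod_scale scalerDr pi_quotmodD.
Qed.

Lemma quotmod_scaleDl u :
  {morph quotmod_scale^~ u : c d / c + d}.
Proof.
by move=> c d; rewrite -[u]reprK !pi_quotmod_scale scalerDl pi_quotmodD.
Qed.

HB.instance Definition _ := GRing.Zmodule_isLmodule.Build k Q
  quotmod_scaleA quotmod_scale1 quotmod_scaleDr quotmod_scaleDl.

End QuotientModule.

Section Ideal.
Variables (k : fieldType) (a n : nat).
Implicit Type g : 'I_n -> {mpoly k[a]}.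

Definition ideal_gen g : {pred {mpoly k[a]}} :=
  fun f => `[< exists h : 'I_n -> {mpoly k[a]}, f = \sum_i h i * g i >].

Lemma ideal_gen_submod_closed g : submod_closed (ideal_gen g).
Proof.
split=> [|c u v /asboolP[hu ->] /asboolP[hv ->]]; apply/asboolP.
  by exists (fun=> 0); rewrite big1 // => i _; rewrite mul0r.
exists (fun i => c *: hu i + hv i).
rewrite scaler_sumr -big_split; apply: eq_bigr => i _ /=.
by rewrite mulrDl scalerAl.
Qed.

HB.instance Definition _ g :=
  GRing.isSubmodClosed.Build k {mpoly k[a]} (ideal_gen g)
    (ideal_gen_submod_closed g).

Lemma ideal_gen_scaler_closed g : scaler_closed (ideal_gen g).
Proof. by move=> c f; exact: rpredZ. Qed.

(* The quotient is only needed as a [k]-module: the quotient rings of         *)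
(* [ring_quotient] require a proper ideal, but here [1] may be a generator.   *)
Definition ideal_quot g : lmodType k :=
  quotmod (@ideal_gen_scaler_closed g).

Definition ideal_gr g (b : nat) (f : {mpoly k[a]}) : Prop :=
  f \in ideal_gen g /\ f \is b.-homog.

Definition ideal_quot_gr g (b : nat) (u : ideal_quot g) : Prop :=
  exists2 f : {mpoly k[a]}, f \is b.-homog &
    u = \pi_(quotmod (@ideal_gen_scaler_closed g)) f.

End Ideal.

Arguments ideal_quot_gr {k a n} g b u.

(* Bounding the degree by [c.+1] makes the type of monomials finite. *)
Definition F (a : nat) (b : int) : nat :=
  if b is Posz c then #|[set m : 'X_{1..a < c.+1} | mdeg m == c]| else 0%N.

Definition strictly_increasing (n r : nat) (j : r.-tuple 'I_n) : bool :=
  sorted ltn [seq val i | i <- j].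

Definition deg_lcm (a n r : nat) (p : 'I_n -> 'X_{1..a}) (j : r.-tuple 'I_n) :
    nat :=
  mdeg (\big[@mlcm a/0%MM]_(i <- j) p i).

(* Main.v *)
Require Import Defs.
From mathcomp Require Import all_boot all_order all_algebra.
From mathcomp Require Import mpoly.
From mathcomp Require Import boolp.

Import GRing.Theory.

Local Open Scope ring_scope.

(** A monomial ideal is spanned over [k] by the monomials that it contains,
    which are the multiples of some generator [p i] ([mem_monomial_ideal]), so
    it has in degree [b] a basis made of the monomials of degree [b] that some
    [p i] divides ([has_dim_ideal_gr]); the classes of the other monomials of
    degree [b] are a basis of the quotient ([has_dim_ideal_quot_gr]).  Both
    Hilbert functions thus count monomials, and they add up to [F a b].

    The monomials of degree [b] in the ideal form the union over [i] of the
    sets [A i] of multiples of [p i], and [inclusion_exclusion] counts them.  For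
    nonempty [J], a monomial is in all the [A i] with [i] in [J] exactly when the lcm
    of these [p i] divides it, and division by this lcm, of degree [d], identifies these
    monomials with those of degree [b - d] ([card_multiples]).  It remains to
    list the nonempty sets [J] by cardinality, as increasing tuples
    ([sum_by_card], [sum_strictly_increasing]). *)

(** * Inclusion-exclusion *)

(** At each point, the indicator of the union is 1 minus the product over [i] of
    1 minus the indicator of [A i]; expanding the product gives one term for
    each [J], and the empty [J] cancels the leading 1. *)
Lemma inclusion_exclusion (I T : finType) (A : I -> {set T}) :
  #|\bigcup_i A i|%:Z =
  \sum_(J : {set I} | J != set0)
     (-1) ^+ (#|J| - 1)%N * #|\bigcap_(i in J) A i|%:Z.
Proof.
have cardZ (B : {set T}) : #|B|%:Z = \sum_x (x \in B)%:R.
  rewrite -natz -sum1_card natr_sum big_mkcond.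
  by apply: eq_bigr => x _; case: ifP.
under [X in _ = X]eq_bigr => J _ do rewrite cardZ mulr_sumr.
rewrite cardZ exchange_big; apply: eq_bigr => x _ /=.
have capE (J : {set I}) :
    (x \in \bigcap_(i in J) A i)%:R = \prod_(i in J) (x \in A i)%:R :> int.
  apply: (big_morph (fun B : {set T} => (x \in B)%:R)) => [B C|].
    by rewrite inE -mulnb natrM.
  by rewrite inE.
have cupE : (x \in \bigcup_i A i)%:R = 1 - \prod_i (1 - (x \in A i)%:R) :> int.
  case: bigcupP => [[i _ xi]|xU].
    by rewrite (bigD1 i) //= xi subrr mul0r subr0.
  rewrite big1 ?subrr // => i _; have [xi|_] := boolP (x \in A i).
    by case: xU; exists i.
  by rewrite subr0.
rewrite cupE.
under eq_bigr => i _ do rewrite addrC.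
rewrite bigA_distr (bigD1 set0) //= [X in 1 - (X + _)]big1 => [|i _]; last first.
  by rewrite inE.
rewrite opprD addNKr -sumrN; apply: eq_bigr => J; rewrite -card_gt0 => J_gt0.
rewrite -big_mkcond capE prodrN.
by rewrite -[in LHS](subnK J_gt0) addn1 exprS !mulN1r mulNr opprK.
Qed.

Lemma sum_by_card (n : nat) (G : {set 'I_n} -> int) :
  \sum_(J : {set 'I_n} | J != set0) G J =
  \sum_(1 <= r < n.+1) \sum_(J : {set 'I_n} | #|J| == r) G J.
Proof.
rewrite (exchange_big_dep predT) //= big_mkcond; apply: eq_bigr => J _.
under eq_bigl => r do rewrite eq_sym.
have Jn : (#|J| <= n)%N by rewrite -[leqRHS]card_ord max_card.
by rewrite big_nat1_eq ltnS Jn andbT card_gt0.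
Qed.

(** [enum] lists the elements of a set of ordinals in increasing order, and this
    is the only increasing list of them: it inverts [j |-> [set i in j]]. *)
Lemma sum_strictly_increasing (n r : nat) (G : {set 'I_n} -> int) :
  \sum_(j : r.-tuple 'I_n | strictly_increasing j) G [set i in j] =
  \sum_(J : {set 'I_n} | #|J| == r) G J.
Proof.
(* The inverse bijection reads [enum J] with [nth], which needs a default value *)
(* in ['I_n]: hence the separate case [n = 0]. *)
have [n0|n_gt0] := posnP n.
  subst n; case: r => [|r]; last first.
    rewrite !big_pred0 // => [J|]; last by case/tupleP=> [[]].
    by apply: contraTF (max_card J) => /eqP ->; rewrite card_ord.
  rewrite (big_pred1 [tuple]) => [|j]; last by rewrite [j]tuple0.
  rewrite (big_pred1 set0) => [|J]; last exact: cards_eq0.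
  by congr G; apply/setP => i; rewrite !inE.
pose i0 := Ordinal n_gt0.
pose enumt (J : {set 'I_n}) : r.-tuple 'I_n :=
  [tuple of mkseq (nth i0 (enum J)) r].
have enumtE (J : {set 'I_n}) : #|J| = r -> enumt J = enum J :> seq _.
  by move=> Jr; rewrite /= -Jr -[RHS](mkseq_nth i0) -cardE.
have sorted_enum (J : {set 'I_n}) : sorted ltn (map val (enum J)).
  rewrite -[enum _](eq_filter (mem_enum _)) -(eq_filter (mem_map val_inj _)).
  rewrite -filter_map (sorted_filter ltn_trans) // -enumT val_enum_ord.
  exact: iota_ltn_sorted.
rewrite [RHS](reindex_onto (fun j : r.-tuple 'I_n => [set i in j]) enumt) /=.
  apply: eq_bigl => j; apply/idP/andP => [j_inc|[/eqP jr /eqP <-]]; last first.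
    by rewrite /strictly_increasing enumtE.
  have jr : #|[set i in j]| = r.
    rewrite cardsE (card_uniqP _) ?size_tuple // -(map_inj_uniq val_inj).
    exact: (sorted_uniq ltn_trans ltnn).
  split; first exact/eqP.
  apply/eqP/val_inj/(inj_map val_inj); rewrite [\val (enumt _)]enumtE //.
  apply: (irr_sorted_eq ltn_trans ltnn) => // x.
  by apply/mapP/mapP => [][i ij ->]; exists i; rewrite // mem_enum inE in ij *.
by move=> J /eqP Jr; apply/setP => i; rewrite inE -[in RHS]mem_enum -enumtE.
Qed.

(** * Monomials of given degree *)

Lemma lepm_biglcm (I : Type) (a : nat) (p : I -> 'X_{1..a}) (s : seq I) m :
  (\big[@mlcm a/0%MM]_(i <- s) p i <= m)%MM = all (fun i => (p i <= m)%MM) s.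
Proof.
elim: s => [|i s IHs]; last by rewrite big_cons lem_mlcm IHs.
by rewrite big_nil; apply/mnm_lepP => i; rewrite mnm0E.
Qed.

(** Division by [q] is a bijection onto the monomials of degree [b - mdeg q]; when
    this is negative, there are no multiples of [q] of degree [b] and [F] is [0]
    by convention. *)
Lemma card_multiples (a b : nat) (q : 'X_{1..a}) :
  #|[set m : 'X_{1..a < b.+1} | (mdeg m == b) && (q <= m)%MM]| =
  F a (b%:Z - (mdeg q)%:Z).
Proof.
have mdegBq (m : 'X_{1..a}) : (q <= m)%MM -> mdeg (m - q) = (mdeg m - mdeg q)%N.
  by move=> qm; rewrite -[in RHS](submK qm) mdegD addnK.
have [qb|bq] := leqP (mdeg q) b; last first.
  have -> : b%:Z - (mdeg q)%:Z = Negz (mdeg q - b).-1.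
    by rewrite NegzE prednK ?subn_gt0 // -subzn 1?ltnW // opprB.
  apply: eq_card0 => m; rewrite !inE; apply/negP => /andP[/eqP mb qm].
  by move: bq; rewrite -mb -(submK qm) mdegD ltnNge leq_addl.
(* The default value [bm0] is never taken on monomials of degree [b - mdeg q]. *)
pose shift (m : 'X_{1..a < (b - mdeg q).+1}) : 'X_{1..a < b.+1} :=
  insubd bm0 (m + q)%MM.
have shiftE (m : 'X_{1..a < (b - mdeg q).+1}) :
    mdeg m == (b - mdeg q)%N -> shift m = (m + q)%MM :> 'X_{1..a}.
  by move=> /eqP md; rewrite val_insubd mdegD md subnK ?ltnS ?leqnn.
rewrite subzn //= -(card_in_imset (f := shift)); last first.
  move=> m m'; rewrite !inE => md md' /(congr1 val) /=.
  by rewrite !shiftE // => /addIm/val_inj.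
apply: eq_card => m; rewrite inE.
apply/andP/imsetP => [[/eqP mb qm]|[m' + ->]]; last first.
  rewrite inE => md'; rewrite shiftE // mdegD (eqP md') subnK //.
  by rewrite eqxx lem_addl.
have md : (mdeg (m - q) < (b - mdeg q).+1)%N by rewrite mdegBq // mb.
exists (BMultinom md); first by rewrite inE /= mdegBq // mb.
by apply: val_inj; rewrite /= shiftE /= ?submK // mdegBq // mb.
Qed.

(** * Bases of monomials *)

(** Indexing a basis by a finite set instead of an initial segment of the naturals
    lets the coefficient of a monomial be a function of that monomial. *)
Lemma has_dim_finset (k : fieldType) (V : lmodType k) (W : V -> Prop)
    (T : finType) (S : {set T}) (e : T -> V) :
  (forall c : T -> k,
     \sum_(m in S) c m *: e m = 0 -> {in S, forall m, c m = 0}) ->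
  (forall v, W v <-> exists c : T -> k, v = \sum_(m in S) c m *: e m) ->
  has_dim W #|S|.
Proof.
move=> freeS spanS; exists (fun i => e (enum_val i)).
pose ext (c : 'I_#|S| -> k) m := oapp c 0 [pick i | enum_val i == m].
have extE c i : ext c (enum_val i) = c i.
  rewrite /ext; case: pickP => [j /eqP/enum_val_inj -> //|/(_ i)].
  by rewrite eqxx.
have sum_ext c :
    \sum_i c i *: e (enum_val i) = \sum_(m in S) ext c m *: e m.
  by rewrite [RHS]big_enum_val; apply: eq_bigr => i _; rewrite extE.
split=> [c|v].
  by rewrite sum_ext => /freeS c0 i; rewrite -extE c0 ?enum_valP.
rewrite spanS; split=> [][c ->].
  by exists (fun i => c (enum_val i)); rewrite [LHS]big_enum_val.
by exists (ext c).
Qed.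

Section MonomialIdeal.
Variables (k : fieldType) (a n : nat) (p : 'I_n -> 'X_{1..a}).

Let g : 'I_n -> {mpoly k[a]} := fun i => 'X_[p i].

(** Divisibility by a generator; membership in the ideal is then
    [mem_monomial_ideal] on a single monomial. *)
Definition monomial_in_ideal (m : 'X_{1..a}) : bool :=
  [exists i, (p i <= m)%MM].

(** The terms of [h * 'X_[p i]] are multiples of [p i], and conversely each
    multiple of [p i] is in the ideal. *)
Lemma mem_monomial_ideal (f : {mpoly k[a]}) :
  (f \in ideal_gen g) = all monomial_in_ideal (msupp f).
Proof.
apply/idP/allP => [/asboolP[h ->] m|fI].
  case/msupp_sum_le/flattenP => s /mapP[i _ ->].
  rewrite (perm_mem (msuppMX _ _)) => /mapP[m' _ ->].
  by apply/existsP; exists i; rewrite lem_addr.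
rewrite [f]mpolyE big_seq; apply: rpred_sum => m /fI/existsP[i pim].
apply: rpredZ; apply/asboolP; exists (fun j => 'X_[m - p i] *+ (j == i)).
rewrite (bigD1 i) //= eqxx mulr1n -mpolyXD submK //.
by rewrite big1 ?addr0 // => j /negPf ->; rewrite mulr0n mul0r.
Qed.

Variable b : nat.

Definition ideal_monomials :=
  [set m : 'X_{1..a < b.+1} | (mdeg m == b) && monomial_in_ideal m].

Definition standard_monomials :=
  [set m : 'X_{1..a < b.+1} | (mdeg m == b) && ~~ monomial_in_ideal m].

Lemma mcoeff_sum_monomials (S : {set 'X_{1..a < b.+1}})
    (c : 'X_{1..a < b.+1} -> k) (m : 'X_{1..a < b.+1}) :
  m \in S -> (\sum_(m' in S) c m' *: 'X_[m'] : {mpoly k[a]})@_m = c m.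
Proof.
move=> mS; rewrite raddf_sum (bigD1 m) //= mcoeffZ mcoeffX eqxx mulr1.
rewrite big1 ?addr0 // => m' /andP[_ m'm].
by rewrite mcoeffZ mcoeffX -bmeqP (negPf m'm) mulr0.
Qed.

Lemma dhomog_sum_monomials (S : {set 'X_{1..a < b.+1}})
    (c : 'X_{1..a < b.+1} -> k) :
  {in S, forall m : 'X_{1..a < b.+1}, mdeg m = b} ->
  (\sum_(m in S) c m *: 'X_[m] : {mpoly k[a]}) \is b.-homog.
Proof.
by move=> Sb; apply: rpred_sum => m /Sb mb; rewrite rpredZ // dhomogX; apply/eqP.
Qed.

Lemma dhomog_split (f : {mpoly k[a]}) : f \is b.-homog ->
  f = \sum_(m in ideal_monomials) f@_m *: 'X_[m]
      + \sum_(m in standard_monomials) f@_m *: 'X_[m].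
Proof.
move=> fb; rewrite [LHS](mpolywE (k := b.+1)); last first.
  by rewrite msizeE; apply/bigmax_leqP_seq => m fm _; rewrite (dhomog_mf fb).
rewrite (bigID (mem ideal_monomials)) /=; congr (_ + _).
rewrite big_mkcond [RHS]big_mkcond; apply: eq_bigr => m _.
rewrite !inE; have [//|/(dhomog_nemf_coeff fb (m := m))->] := eqVneq (mdeg m) b.
by rewrite scale0r.
Qed.

Lemma sum_ideal_monomials (c : 'X_{1..a < b.+1} -> k) :
  \sum_(m in ideal_monomials) c m *: 'X_[m] \in ideal_gen g.
Proof.
apply: rpred_sum => m; rewrite inE => /andP[_ mI]; apply: rpredZ.
by rewrite mem_monomial_ideal msuppX /= mI.
Qed.

Lemma has_dim_ideal_gr : has_dim (ideal_gr g b) #|ideal_monomials|.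
Proof.
apply: (has_dim_finset _ _ _ _ _ (fun m => 'X_[bmnm m])) => [c c0 m mS|f].
  by rewrite -(mcoeff_sum_monomials _ c _ mS) c0 mcoeff0.
split=> [[fI fb]|[c ->]]; last first.
  split; last by apply: dhomog_sum_monomials => m; rewrite inE => /andP[/eqP].
  exact: sum_ideal_monomials.
exists (fun m : 'X_{1..a < b.+1} => f@_m).
rewrite [LHS]dhomog_split // [X in _ + X]big1 ?addr0 //.
move=> m; rewrite inE => /andP[_ mI]; rewrite memN_msupp_eq0 ?scale0r //.
by apply: contra mI => /(allP _); apply; rewrite -mem_monomial_ideal.
Qed.

Let piQ (f : {mpoly k[a]}) : ideal_quot g :=
  (\pi_(quotmod (@ideal_gen_scaler_closed k a n g)) f)%qT.

Lemma piQ_eq0 f : (piQ f == 0) = (f \in ideal_gen g).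
Proof.
rewrite -[f in RHS]subr0 Quotient.idealrBE.
rewrite -[RHS]/(piQ f == piQ 0).
suff -> : piQ 0 = 0 by [].
by apply: (addrI (piQ 0)); rewrite -[LHS]pi_quotmodD !addr0.
Qed.

Lemma piQ_sum (T : finType) (S : {set T}) (c : T -> k) (e : T -> {mpoly k[a]}) :
  piQ (\sum_(m in S) c m *: e m) = \sum_(m in S) c m *: piQ (e m).
Proof.
have piQ0 : piQ 0 = 0 by apply/eqP; rewrite piQ_eq0 rpred0.
rewrite (big_morph piQ (pi_quotmodD (@ideal_gen_scaler_closed k a n g)) piQ0).
apply: eq_bigr => m _; exact/esym/pi_quotmod_scale.
Qed.

(** A combination of standard monomials that vanishes in the quotient lies in the
    ideal, so by [mem_monomial_ideal] all its terms do, and none is left.  For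
    the span, drop the terms that lie in the ideal. *)
Lemma has_dim_ideal_quot_gr :
  has_dim (ideal_quot_gr g b) #|standard_monomials|.
Proof.
apply: (has_dim_finset _ _ _ _ _ (fun m => piQ 'X_[bmnm m])) => [c|u].
  rewrite -piQ_sum => /eqP; rewrite piQ_eq0 mem_monomial_ideal => /allP cI m mS.
  rewrite -(mcoeff_sum_monomials _ c _ mS); apply/eqP; rewrite mcoeff_eq0.
  by apply/negP => /cI mI; move: mS; rewrite inE mI andbF.
split=> [[f fb ->]|[c ->]]; last first.
  exists (\sum_(m in standard_monomials) c m *: 'X_[m]).
    by apply: dhomog_sum_monomials => m; rewrite inE => /andP[/eqP].
  by rewrite -piQ_sum.
exists (fun m : 'X_{1..a < b.+1} => f@_m).
have I0 : piQ (\sum_(m in ideal_monomials) f@_m *: 'X_[m]) = 0.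
  by apply/eqP; rewrite piQ_eq0 sum_ideal_monomials.
by rewrite -piQ_sum -[RHS]add0r -I0 -[RHS]pi_quotmodD -dhomog_split.
Qed.

End MonomialIdeal.

Arguments ideal_monomials {a n} p b.
Arguments standard_monomials {a n} p b.

Theorem mainTheorem1 (k : fieldType) (a n : nat) (ha : (1 <= a)%N)
  (hn : (1 <= n)%N) (p : 'I_n -> 'X_{1..a}) (b : nat) :
  let g : 'I_n -> {mpoly k[a]} := fun i => 'X_[p i] in
  (HF (ideal_gr g) b)%:Z =
    \sum_(1 <= r < n.+1) (-1) ^+ (r - 1)%N *
      \sum_(j : r.-tuple 'I_n | strictly_increasing j)
        (F a (b%:Z - (deg_lcm p j)%:Z))%:Z
  /\
  (HF (ideal_quot_gr g) b)%:Z =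
    (F a b%:Z)%:Z -
    \sum_(1 <= r < n.+1) (-1) ^+ (r - 1)%N *
      \sum_(j : r.-tuple 'I_n | strictly_increasing j)
        (F a (b%:Z - (deg_lcm p j)%:Z))%:Z.
Proof.
move=> g.
pose A i := [set m : 'X_{1..a < b.+1} | (mdeg m == b) && (p i <= m)%MM].
have idealE : ideal_monomials p b = \bigcup_i A i.
  apply/setP => m; rewrite inE; apply/andP/bigcupP => [[mb /existsP[i im]]|[i _]].
    by exists i; rewrite // inE mb.
  by rewrite inE => /andP[-> im]; split=> //; apply/existsP; exists i.
have termE r (j : r.-tuple 'I_n) : (0 < r)%N ->
    F a (b%:Z - (deg_lcm p j)%:Z) = #|\bigcap_(i in [set i in j]) A i|.
  move=> r_gt0; rewrite -card_multiples; apply: eq_card => m.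
  rewrite inE lepm_biglcm; apply/andP/bigcapP => [[mb /allP jm] i|mA].
    by rewrite !inE => ij; rewrite mb jm.
  have inA i : i \in j -> (mdeg m == b) && (p i <= m)%MM.
    by move=> ij; have := mA i; rewrite !inE; apply.
  split; last by apply/allP => i /inA/andP[].
  (* The degree condition comes from any one index of [j], which [0 < r] *)
  (* provides; the intersection over no index would be the full set. *)
  by have /andP[] := inA _ (mem_tnth (Ordinal r_gt0) j).
have sumE : \sum_(1 <= r < n.+1) (-1) ^+ (r - 1)%N *
      \sum_(j : r.-tuple 'I_n | strictly_increasing j)
        (F a (b%:Z - (deg_lcm p j)%:Z))%:Z = #|ideal_monomials p b|%:Z.
  rewrite idealE inclusion_exclusion sum_by_card !big_nat.
  apply: eq_bigr => r /andP[r_gt0 _].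
  under [in LHS]eq_bigr => j _ do rewrite termE //.
  rewrite (sum_strictly_increasing _ _ (fun J => #|\bigcap_(i in J) A i|%:Z)).
  by rewrite mulr_sumr; apply: eq_bigr => J /eqP ->.
rewrite /HF (dimensionE (has_dim_ideal_gr _ _ _ _ _)).
rewrite (dimensionE (has_dim_ideal_quot_gr _ _ _ _ _)) sumE; split=> //.
have -> : F a b = (#|ideal_monomials p b| + #|standard_monomials p b|)%N.
  rewrite /F -(cardsID (ideal_monomials p b)).
  congr (_ + _)%N; apply: eq_card => m; rewrite !inE.
    by rewrite andbA andbb.
  by case: (mdeg m == b); rewrite ?andbT ?andbF.
by rewrite PoszD addrC addKr.
Qed.
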